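(* Let $q>1$, let $(V,E,\mu)$ be a weighted graph as in the context (vertex weight $\sigma\equiv1$, edge length $\rho\equiv1$), and let $o\in V$. Suppose that $$\sum_{n=1}^\infty\frac{n}{\mu(B(o,n))^{q-1}}=\infty,$$ where $B(o,n)$ is the closed graph-distance ball. Then the equation $$\partial_tu-\Delta u=u^q\qquad\text{on }(0,\infty)\times V$$ admits no positive global classical solution. Moreover, for every nontrivial nonnegative initial datum $u_0:V\to[0,\infty)$, the Cauchy problem $$\partial_tu-\Delta u=u^q\ \ (t>0,\ x\in V),\qquad u(0,x)=u_0(x)\ \ (x\in V),$$ admits no nonnegative global classical solution.
   Context: Let $(V,E)$ be an infinite, connected, locally finite graph with at most one edge between two distinct vertices and no loops. Let $\mu:V\times V\to[0,\infty)$ be symmetric with $\mu_{xy}>0$ if $x\sim y$ and $\mu_{xy}=0$ otherwise; put $\mu(x)=\sum_{y\sim x}\mu_{xy}$ and $\mu(A)=\sum_{x\in A}\mu(x)$. The normalized graph Laplacian is $$\Delta f(x)=\frac1{\mu(x)}\sum_{y\sim x}\mu_{xy}(f(y)-f(x)).$$ The graph distance $d$ is the minimal number of edges of a path joining two vertices, and $B(o,n)=\{x\in V:d(o,x)\le n\}$. A positive global classical solution of $\partial_tu-\Delta u=u^q$ on $(0,\infty)\times V$ is a function $u:(0,\infty)\times V\to(0,\infty)$ with $u(\cdot,x)\in C^1((0,\infty))$ for every $x$ satisfying the equation pointwise (no value or trace at $t=0$ is assumed). A nonnegative global classical solution of the Cauchy problem is a function $u:[0,\infty)\times V\to[0,\infty)$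 with $u(\cdot,x)\in C([0,\infty))\cap C^1((0,\infty))$ for every $x\in V$, satisfying the equation pointwise for $t>0$ and $u(0,\cdot)=u_0$. *)

(* Defs.v *)
From HB Require Import structures.
From mathcomp Require Import all_boot all_order all_algebra.
From mathcomp Require Import all_classical all_reals all_analysis.

Set Implicit Arguments.
Unset Strict Implicit.
Unset Printing Implicit Defensive.

Import Order.TTheory GRing.Theory Num.Theory.
Import numFieldNormedType.Exports.

Local Open Scope classical_set_scope.
Local Open Scope ring_scope.

Record weighted_graph (R : realType) (V : choiceType) := WeightedGraph {
  adj : rel V ;
  weight : V -> V -> R ;
  adj_sym : symmetric adj ;
  adj_irr : irreflexive adj ;
  adj_locally_finite : forall x, finite_set [set y | adj x y] ;
  adj_connected : forall x y, exists p, path adj x p /\ last x p = y ;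
  vertex_infinite : infinite_set [set: V] ;
  weight_sym : forall x y, weight x y = weight y x ;
  weight_adj : forall x y, adj x y -> 0 < weight x y ;
  weight_nadj : forall x y, ~~ adj x y -> weight x y = 0
}.

Section WeightedGraph.
Context {R : realType} {V : choiceType} (G : weighted_graph R V).

Definition walk_of_length (x y : V) (n : nat) : Prop :=
  exists p : seq V, [/\ path (adj G) x p, last x p = y & size p = n].

Fact walk_exists (x y : V) : exists n, `[< walk_of_length x y n >].
Proof.
by have [p [xp py]] := adj_connected G x y; exists (size p); apply/asboolP; exists p.
Qed.

Definition gdist (x y : V) : nat := ex_minn (walk_exists x y).

Definition gball (o : V) (n : nat) : set V := [set x | (gdist o x <= n)%N].

Definition vertex_measure (x : V) : R :=
  \sum_(y \in [set y | adj G x y]) weight G x y.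

(* Meant for finite sets such as balls: [\sum_(_ \in _)] is 0 when the support
   of the summand is infinite. *)
Definition set_measure (A : set V) : R := \sum_(x \in A) vertex_measure x.

Definition laplacian (f : V -> R) (x : V) : R :=
  (vertex_measure x)^-1 *
  \sum_(y \in [set y | adj G x y]) weight G x y * (f y - f x).

(* As ]0, +oo[ is open, two-sided derivatives and continuity at each of its
   points express that f is of class C^1 on it; the values of f outside
   ]0, +oo[ are irrelevant. *)
Definition C1_pos (f : R -> R) : Prop :=
  forall t : R, 0 < t -> derivable f t 1 /\ {for t, continuous (derive1 f)}.

Definition solves_heat (q : R) (u : R -> V -> R) : Prop :=
  forall (t : R) (x : V), 0 < t ->
    derive1 (u ^~ x) t - laplacian (u t) x = u t x `^ q.

(* A function on (0, oo) x V is represented by a function on R x V whose values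
   at t <= 0 are unconstrained; similarly for [0, oo) x V below. *)
Definition positive_global_solution (q : R) (u : R -> V -> R) : Prop :=
  [/\ forall (t : R) (x : V), 0 < t -> 0 < u t x,
      forall x : V, C1_pos (u ^~ x)
    & solves_heat q u].

Definition nonneg_global_cauchy_solution (q : R) (u0 : V -> R)
    (u : R -> V -> R) : Prop :=
  [/\ forall (t : R) (x : V), 0 <= t -> 0 <= u t x,
      forall x : V, {within `[0, +oo[, continuous (u ^~ x)},
      forall x : V, C1_pos (u ^~ x),
      solves_heat q u
    & forall x : V, u 0 x = u0 x].

End WeightedGraph.

(* Main.v *)
Require Import Defs.
From HB Require Import structures.
From mathcomp Require Import all_boot all_order all_algebra.
From mathcomp Require Import all_classical all_reals all_analysis.
From mathcomp Require Import finmap lra ring zify.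

Set Implicit Arguments.
Unset Strict Implicit.
Unset Printing Implicit Defensive.

Import Order.TTheory GRing.Theory Num.Theory.
Import numFieldNormedType.Exports.

Local Open Scope classical_set_scope.
Local Open Scope ring_scope.

(** Let d be the distance to o, and let u >= 0 solve the equation. The proof
    bounds the mass I(t), the sum over x of mu(x) F(u(t, x)) psi(t, x)^p, where
    psi is a cut-off function, F is an increasing concave function with
    u <= F(u) <= 2 u, and p is a large exponent.

    The cut-off is a function of d(x)^2 + t, as parabolic scaling suggests; it
    decreases from 1 to 0 with slope - w(M) at d(x)^2 + t = M. Its time
    derivative costs a term of order u psi^(p-1) w, which Young's inequality
    bounds by u^q psi^p / 2 + C w^(q/(q-1)). With w(M) proportional to
    V^(1-q), where V is the volume of the ball of radius about sqrt M, and
    normalised to have sum 1, the error terms add up over space-time to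
    C S^(-1/(q-1)), where S is the sum of the V^(1-q) ([error_bound]). Comparing
    blocks, S tends to infinity with the support of w because the sum of
    n / mu(B(o, n))^(q-1) diverges ([condensation_unbounded]).

    The Laplacian of psi is not controlled, as nothing is known on second
    differences of d; only one integration by parts is possible
    ([energy_lower_bound]), and the term with the gradient of psi, whose square
    is of order M w^2, has to be compensated by the concavity of F. A power
    u^(1-a) would lose the critical case. Instead, F' changes by an amount dl_k,
    equal to the decrease of psi over the k-th dyadic block (of order M w), when
    u passes through the size z_k with z_k^(q-1) = w. These amounts add up to 1,
    so that 1 <= F' <= 2, and completing the square leaves an error
    M w^2 / dl_k of order w, exactly as for the time derivative. On a graph
    there is no chain rule; [edge_inequality] carries this out on the values at
    the two ends of an edge.

    Consequently mu(o) u(t, o) <= I(t) <= C S^(-1/(q-1)) for all t > 0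
    ([solution_decay]), so u vanishes at o, and the equation propagates this to
    all vertices ([solution_vanishes]). This contradicts positivity, or, by
    continuity at time 0, the nontriviality of the initial datum. *)

(** * Inequalities for real powers *)

Lemma powR_mvt (R : realType) (r x y : R) : 0 < x -> x <= y ->
  exists2 z, x <= z <= y & y `^ r - x `^ r = r * z `^ (r - 1) * (y - x).
Proof.
move=> x0 xy.
have [||z zxy E] := @MVT_segment R (@powR R ^~ r) (fun z => r * z `^ (r - 1)) x y xy.
- move=> z; rewrite in_itv /= => /andP[xz _].
  by apply: is_derive1_powR; exact: lt_trans xz.
- apply: derivable_within_continuous => z; rewrite in_itv /= => /andP[xz _].
  by apply: derivable_powR; rewrite in_itv /= andbT; exact: lt_le_trans xz.
- by exists z => //; move: zxy; rewrite in_itv.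
Qed.

Lemma powR_bernoulli (R : realType) (r s : R) : 0 <= r <= 1 -> 0 <= s ->
  0 <= (1 + s) `^ r - 1 <= r * s.
Proof.
move=> /andP[r0 r1] s0.
have [|z /andP[z1 zs]] := @powR_mvt R r 1 (1 + s) ltr01; first by lra.
have -> : (1 : R) `^ r = 1 by rewrite powR1.
move=> ->.
have z1' : z `^ (r - 1) <= 1.
  by rewrite -[leRHS](powRr0 z); apply: ler_powR => //; lra.
have := powR_ge0 z (r - 1).
move: (z `^ _) z1' => t t1 t0; rewrite (_ : 1 + s - 1 = s); last by ring.
apply/andP; split; first by rewrite !mulr_ge0.
by rewrite ler_wpM2r // ler_piMr.
Qed.

Lemma powRN_convex (R : realType) (c x y : R) : 0 <= c -> 0 < x -> x <= y ->
  c * (y - x) / y `^ (1 + c) <= x `^ (- c) - y `^ (- c).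
Proof.
move=> c0 x0 xy; have [z /andP[xz zy] E] := powR_mvt (- c) x0 xy.
rewrite (_ : x `^ (- c) - _ = c * (y - x) * z `^ (- c - 1)); last first.
  by rewrite -[LHS]opprB E; ring.
rewrite ler_wpM2l ?mulr_ge0 ?subr_ge0 //.
rewrite (_ : - c - 1 = - (1 + c)); last by ring.
have z0 : 0 < z by lra.
have y0 : 0 < y by lra.
rewrite powRN lef_pV2 ?posrE ?powR_gt0 //.
by apply: ge0_ler_powR => //; rewrite ?nnegrE; lra.
Qed.

Lemma powR_rescale (R : realType) (q z a : R) : 0 < z -> 0 <= a ->
  z * (z `^ (q - 1) * (a / z) `^ q) = a `^ q.
Proof.
move=> z0 a0; rewrite mulrA (mulrC z) -{2}(powRr1 (ltW z0)).
rewrite -powRD; last by apply/implyP => _; exact: lt0r_neq0.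
rewrite subrK -powRM ?(ltW z0) // ?divr_ge0 ?(ltW z0) //.
by congr powR; field; exact: lt0r_neq0.
Qed.

(** Young's inequality between the powers 1 + c and q of s, in which the right
    side carries two more factors p than the left one. This loss is possible
    because n is large: where p ^ 2 * s ^ (q - 1 - c) is below a threshold, the
    n factors p on the left outweigh s ^ (1 + c). In the application p is the
    cut-off and s is the solution divided by its natural size. *)
Lemma power_absorption (R : realType) (q c : R) : 0 < c < 1 -> 1 + c < q ->
  exists2 n : nat, (0 < n)%N & forall C0 : R, 0 < C0 ->
  exists2 C : R, 0 <= C & forall s p : R, 0 <= s -> 0 <= p <= 1 ->
    C0 * p ^+ n * (1 + s) `^ (1 + c) <= 2^-1 * p ^+ n.+2 * s `^ q + C.
Proof.
move=> /andP[c0 c1] cq.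
pose k := (1 + c) / (q - 1 - c).
have k0 : 0 < k by rewrite divr_gt0 //; lra.
exists (Num.truncn (2 * k)).+1 => // C0 C00.
set n := (Num.truncn (2 * k)).+1.
have kn : 2 * k <= n%:R by apply/ltW; exact: truncnS_gt.
exists (4 * C0 + 4 * C0 * (8 * C0) `^ k).
  by rewrite addr_ge0 ?mulr_ge0 ?powR_ge0 ?ltW.
move=> s p s0 /andP[p0 p1].
have pn0 : 0 <= p ^+ n by rewrite exprn_ge0.
have pn1 : p ^+ n <= 1 by rewrite exprn_ile1.
have two : (2 : R) `^ (1 + c) <= 4.
  rewrite (_ : 4 = 2 `^ 2%:R); last by rewrite powR_mulrn //; ring.
  by apply: ler_powR; lra.
have C0p := powR_ge0 (8 * C0) k.
have R0 : 0 <= 2^-1 * p ^+ n.+2 * s `^ q.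
  by rewrite !mulr_ge0 ?exprn_ge0 ?powR_ge0.
(* the lower-order regime s <= 1 contributes only a constant *)
have [s1|s1] := leP s 1.
  have H : (1 + s) `^ (1 + c) <= 4.
    apply: le_trans two; apply: ge0_ler_powR; rewrite ?nnegrE; lra.
  have H2 : p ^+ n * (1 + s) `^ (1 + c) <= 4.
    by rewrite -[leRHS]mul1r; apply: ler_pM => //; rewrite powR_ge0.
  have : C0 * p ^+ n * (1 + s) `^ (1 + c) <= 4 * C0.
    by rewrite -mulrA (mulrC 4) ler_wpM2l // ltW.
  have : 0 <= 4 * C0 * (8 * C0) `^ k by rewrite !mulr_ge0 // ltW.
  by lra.
have H : (1 + s) `^ (1 + c) <= 4 * s `^ (1 + c).
  apply: (@le_trans _ _ ((2 * s) `^ (1 + c))).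
    by apply: ge0_ler_powR; rewrite ?nnegrE; lra.
  by rewrite powRM // ler_wpM2r ?powR_ge0.
have H1 : C0 * p ^+ n * (1 + s) `^ (1 + c) <= 4 * C0 * p ^+ n * s `^ (1 + c).
  rewrite (_ : 4 * C0 * p ^+ n * _ = C0 * p ^+ n * (4 * s `^ (1 + c))); last by ring.
  by rewrite ler_wpM2l // mulr_ge0 // ltW.
apply: (le_trans H1).
have sp0 := powR_ge0 s (1 + c).
have [big|small] := leP (8 * C0) (p ^+ 2 * s `^ (q - 1 - c)).
  have -> : s `^ q = s `^ (q - 1 - c) * s `^ (1 + c).
    rewrite -powRD; first by congr powR; ring.
    by apply/implyP => _; apply/eqP; lra.
  have : 8 * C0 * (p ^+ n * s `^ (1 + c)) <=
     p ^+ 2 * s `^ (q - 1 - c) * (p ^+ n * s `^ (1 + c)).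
    by rewrite ler_wpM2r // mulr_ge0.
  rewrite (_ : p ^+ n.+2 = p ^+ n * p ^+ 2); last by rewrite -exprD addn2.
  have : 0 <= 4 * C0 * (8 * C0) `^ k by rewrite !mulr_ge0 // ltW.
  have : 0 <= 4 * C0 by lra.
  by lra.
have pk : p ^+ n * s `^ (1 + c) <= (8 * C0) `^ k.
  apply: (@le_trans _ _ ((p ^+ 2 * s `^ (q - 1 - c)) `^ k)); last first.
    apply: ge0_ler_powR; rewrite ?nnegrE; [lra| |lra|exact: ltW].
    by rewrite mulr_ge0 ?exprn_ge0 ?powR_ge0.
  rewrite powRM ?exprn_ge0 ?powR_ge0 // -(powRrM s) /k mulrC.
  rewrite (_ : (q - 1 - c) * ((1 + c) / (q - 1 - c)) = 1 + c); last first.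
    by field; apply/eqP; lra.
  rewrite [leRHS]mulrC ler_wpM2l // -powR_mulrn // -(powR_mulrn 2) // -powRrM.
  have [p00|p00] := ltP 0 p; first by apply: ger_powR => //; rewrite p00.
  have -> : p = 0 by lra.
  by rewrite !powR0 ?pnatr_eq0 // mulf_neq0 // gt_eqF.
have : 4 * C0 * (p ^+ n * s `^ (1 + c)) <= 4 * C0 * (8 * C0) `^ k.
  by rewrite ler_wpM2l //; lra.
by lra.
Qed.

(** * The concave test function and the inequality on one edge *)

Section ConcaveTest.
Context {R : realType} (c : R) (K : nat) (dl z : nat -> R).

(** A perturbation of the identity that bends near each of the sizes z k, with
    a total change of slope dl k there. Its concavity is what pays for the
    gradient of the cut-off in [edge_inequality]. *)
Definition concave_test (a : R) : R :=
  a + \sum_(k < K) dl k * (z k * ((1 + a / z k) `^ (1 - c) - 1) / (1 - c)).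

Definition concave_slope (a : R) : R :=
  1 + \sum_(k < K) dl k * (1 + a / z k) `^ (- c).

Hypothesis c01 : 0 < c < 1.
Hypothesis dl_ge0 : forall k, 0 <= dl k.
Hypothesis dl_le1 : \sum_(k < K) dl k <= 1.
Hypothesis z_gt0 : forall k, 0 < z k.

Let c0 : 0 < c. Proof. by case/andP: c01. Qed.
Let c1 : c < 1. Proof. by case/andP: c01. Qed.

Let base_ge1 k (a : R) : 0 <= a -> 1 <= 1 + a / z k.
Proof. by move=> a0; rewrite lerDl divr_ge0 // ltW. Qed.

Lemma concave_slope_ge1 (a : R) : 1 <= concave_slope a.
Proof. by rewrite lerDl sumr_ge0 // => k _; rewrite mulr_ge0 ?powR_ge0. Qed.

Lemma concave_slope_le2 (a : R) : 0 <= a -> concave_slope a <= 2.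
Proof.
move=> a0; rewrite (_ : 2 = 1 + 1) // lerD2l (le_trans _ dl_le1) //.
apply: ler_sum => k _; rewrite ler_piMr //.
rewrite -[leRHS](powRr0 (1 + a / z k)); apply: ler_powR; first exact: base_ge1.
by rewrite oppr_le0 ltW.
Qed.

(** Every summand of the slope is nonincreasing, so the k-th one alone bounds
    the drop from below, and that one is a convex function. *)
Lemma concave_slope_drop (k : nat) (a b : R) : (k < K)%N -> 0 <= a -> a <= b ->
  dl k * (c * ((b - a) / z k) / (1 + b / z k) `^ (1 + c)) <=
  concave_slope a - concave_slope b.
Proof.
move=> kK a0 ab.
have drop j : c * ((b - a) / z j) / (1 + b / z j) `^ (1 + c) <=
    (1 + a / z j) `^ (- c) - (1 + b / z j) `^ (- c).
  have -> : (b - a) / z j = (1 + b / z j) - (1 + a / z j) by ring.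
  apply: powRN_convex; first exact: ltW.
    by rewrite (lt_le_trans ltr01) // base_ge1.
  by rewrite lerD2l ler_pM2r // invr_gt0.
rewrite /concave_slope opprD addrACA subrr add0r -sumrB (bigD1 (Ordinal kK)) //= -[leLHS]addr0.
apply: lerD; first by rewrite -mulrBr ler_wpM2l.
apply: sumr_ge0 => j _; rewrite -mulrBr mulr_ge0 //; apply: le_trans (drop j).
rewrite divr_ge0 ?powR_ge0 // mulr_ge0 ?(ltW c0) // divr_ge0 ?subr_ge0 //.
exact: ltW.
Qed.

Lemma concave_slope_anti (a b : R) : 0 <= a -> a <= b ->
  concave_slope b <= concave_slope a.
Proof.
move=> a0 ab; rewrite lerD2l; apply: ler_sum => k _; rewrite ler_wpM2l //.
have A1 := base_ge1 k a0; have B1 := base_ge1 k (le_trans a0 ab).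
rewrite !powRN lef_pV2 ?posrE ?powR_gt0 ?(lt_le_trans ltr01) //.
apply: ge0_ler_powR; rewrite ?nnegrE ?(ltW c0) ?(le_trans ler01) //.
by rewrite lerD2l ler_pM2r // invr_gt0.
Qed.

Lemma concave_test_bounds (a : R) : 0 <= a -> a <= concave_test a <= 2 * a.
Proof.
move=> a0.
have term k : 0 <= z k * ((1 + a / z k) `^ (1 - c) - 1) / (1 - c) <= a.
  have c01' : 0 <= 1 - c <= 1 by have := c0; have := c1; lra.
  have az : 0 <= a / z k by rewrite divr_ge0 // ltW.
  have /andP[H0 H1] := powR_bernoulli c01' az.
  apply/andP; split.
    by rewrite divr_ge0 ?subr_ge0 ?(ltW c1) // mulr_ge0 // ltW.
  rewrite ler_pdivrMr ?subr_gt0 //.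
  rewrite (_ : a * (1 - c) = z k * ((1 - c) * (a / z k))).
    by rewrite ler_wpM2l // ltW.
  by field; exact: lt0r_neq0.
rewrite /concave_test lerDl; apply/andP; split.
  by apply: sumr_ge0 => k _; rewrite mulr_ge0 //; case/andP: (term k).
rewrite (_ : 2 * a = a + a); last by ring.
rewrite lerD2l; apply: (@le_trans _ _ (\sum_(k < K) dl k * a)).
  by apply: ler_sum => k _; rewrite ler_wpM2l //; case/andP: (term k).
by rewrite -mulr_suml ler_piMl.
Qed.

Lemma is_derive_concave_test (a : R) : 0 <= a ->
  is_derive a 1 concave_test (concave_slope a).
Proof.
move=> a0.
have term k : is_derive a 1
    (fun a : R => dl k * (z k * ((1 + a / z k) `^ (1 - c) - 1) / (1 - c)))
    (dl k * (1 + a / z k) `^ (- c)).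
  have b0 : 0 < 1 + a / z k by rewrite (lt_le_trans ltr01) // base_ge1.
  pose g := cst 1 + (z k)^-1 \*: (@id R).
  have gE x : g x = 1 + x / z k by rewrite /g fctE /= /GRing.scale /= mulrC.
  have H : is_derive a 1 g (z k)^-1.
    by apply: is_derive_eq; rewrite add0r scaler1.
  have gp : 0 < g a by rewrite gE.
  have H2 := @is_derive1_comp R (@powR R ^~ (1 - c)) g a _ _
    (is_derive1_powR _ gp) H.
  have -> : (fun a : R => dl k * (z k * ((1 + a / z k) `^ (1 - c) - 1) / (1 - c)))
    = (dl k * z k / (1 - c)) \*: (((@powR R ^~ (1 - c)) \o g) - cst 1).
    by apply/funext => x /=; rewrite /GRing.scale /= !fctE /= gE; ring.
  apply: is_derive_eq; rewrite subr0 /GRing.scale /= gE.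
  rewrite (_ : 1 - c - 1 = - c); last by ring.
  have := z_gt0 k; have : 1 - c != 0 by rewrite subr_eq0 gt_eqF.
  by move=> ? /lt0r_neq0 ?; field; apply/andP.
have -> : concave_test = id + \sum_(k < K)
   (fun a : R => dl k * (z k * ((1 + a / z k) `^ (1 - c) - 1) / (1 - c))).
  by apply/funext => x; rewrite /concave_test fctE fct_sumE.
exact: is_deriveD.
Qed.

(** The contribution of one edge to the integration by parts: the cut-off takes
    the values psx <= psy at the two ends, and the solution the values a and b.
    In the only bad case a < b, the variation of psx ^+ n.+2 produces a term
    linear in b - a with the wrong sign, while the drop of the slope between a
    and b produces a quadratic one with the right sign. Completing the square
    leaves (psy - psx)^2 / dl k, which is of order w when dl k is at least of
    order L^2 w, and [power_absorption] concludes. The whole loss is charged to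
    the end where the cut-off is larger. The value w = z k `^ (q - 1) says that
    z k is the size of the solution at which u^q and w u are comparable. *)
Lemma edge_inequality (q : R) (n k : nat) (C L w psx psy a b : R) :
  (0 < n)%N -> 0 <= C ->
  (forall s p : R, 0 <= s -> 0 <= p <= 1 ->
     16 * n.+2%:R ^+ 2 / c * p ^+ n * (1 + s) `^ (1 + c) <=
     2^-1 * p ^+ n.+2 * s `^ q + C) ->
  (k < K)%N -> w = z k `^ (q - 1) -> 0 < dl k -> L ^+ 2 * w <= 16 * dl k ->
  0 <= a -> 0 <= b -> 0 <= psx -> psx <= psy -> psy <= 1 -> psy - psx <= L * w ->
  - (2^-1 * psy ^+ n.+2 * b `^ q + C * (w * z k)) <=
  (b - a) * (psx ^+ n.+2 * concave_slope a - psy ^+ n.+2 * concave_slope b).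
Proof.
move=> n0 C0 absorb kK wE dk0 Lw a0 b0 x0 xy y1 Hd.
have zk := z_gt0 k.
have y0 : 0 <= psy := le_trans x0 xy.
have w0 : 0 <= w by rewrite wE powR_ge0.
set N : R := n.+2%:R in absorb *.
have N0 : 0 <= N by rewrite /N.
have Xb := concave_slope_le2 a0; have Xb1 := concave_slope_ge1 a.
have Yb := concave_slope_ge1 b.
set X := concave_slope a in Xb Xb1 *; set Y := concave_slope b in Yb *.
have fxy : psx ^+ n.+2 <= psy ^+ n.+2 by rewrite lerXn2r.
have fx0 : 0 <= psx ^+ n.+2 by rewrite exprn_ge0.
have ps0 m : 0 <= psy ^+ m by rewrite exprn_ge0.
have rhs0 : 0 <= 2^-1 * psy ^+ n.+2 * b `^ q + C * (w * z k).
  apply: addr_ge0; first by rewrite mulr_ge0 ?powR_ge0 // mulr_ge0.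
  by rewrite mulr_ge0 // mulr_ge0 // ltW.
have [ba|ab] := leP b a.
  apply: (@le_trans _ _ 0); first by rewrite oppr_le0.
  have XY : X <= Y by apply: concave_slope_anti.
  rewrite mulr_le0 ?subr_le0 //.
  by apply: ler_pM => //; exact: le_trans ler01 Xb1.
(* bounding the telescoped difference of powers by its largest term *)
have eta : psy ^+ n.+2 - psx ^+ n.+2 <= N * psy ^+ n.+1 * (L * w).
  rewrite subrXX; apply: (@le_trans _ _ ((psy - psx) * (N * psy ^+ n.+1))).
    rewrite ler_wpM2l ?subr_ge0 //.
    apply: (@le_trans _ _ (\sum_(i < n.+2) psy ^+ n.+1)); last first.
      by rewrite sumr_const card_ord -mulr_natl.
    apply: ler_sum => i _.
    rewrite (_ : psy ^+ n.+1 = psy ^+ (n.+2.-1 - i) * psy ^+ i); last first.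
      by rewrite -exprD subnK // -ltnS.
    by rewrite ler_wpM2l ?exprn_ge0 // lerXn2r.
  by rewrite mulrC ler_wpM2l // mulr_ge0 ?exprn_ge0.
set D := (b - a) / z k.
have D0 : 0 < D by rewrite divr_gt0 ?subr_gt0.
have bz : 0 <= b / z k by rewrite divr_ge0 // ltW.
set A := (1 + b / z k) `^ (1 + c).
have A0 : 0 < A by rewrite powR_gt0 // ltr_wpDr.
pose kp := dl k * c / A.
have kp0 : 0 < kp by rewrite divr_gt0 // mulr_gt0.
have drop : kp * D <= X - Y.
  have := concave_slope_drop kK a0 (ltW ab); rewrite -/A -/D -/X -/Y.
  by congr (_ <= _); rewrite /kp; ring.
(* completing the square in the rescaled jump D *)
have square : 2 * (N * psy ^+ n.+1 * (L * w)) * D - psy ^+ n.+2 * (kp * D) * D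
     <= psy ^+ n * ((N * L * w) ^+ 2 / kp).
  rewrite -subr_ge0.
  rewrite (_ : _ - _ = psy ^+ n * (psy * kp * D - N * L * w) ^+ 2 / kp).
    by rewrite divr_ge0 ?(ltW kp0) // mulr_ge0 // sqr_ge0.
  by rewrite !exprS; field; exact: lt0r_neq0.
have kpb : (N * L * w) ^+ 2 / kp <= 16 * N ^+ 2 / c * A * w.
  rewrite ler_pdivrMr //.
  rewrite (_ : 16 * N ^+ 2 / c * A * w * kp = N ^+ 2 * w * (16 * dl k)); last first.
    by rewrite /kp; field; rewrite !lt0r_neq0.
  rewrite (_ : (N * L * w) ^+ 2 = N ^+ 2 * w * (L ^+ 2 * w)); last by ring.
  by rewrite ler_wpM2l // mulr_ge0 // sqr_ge0.
have main : D * ((psy ^+ n.+2 - psx ^+ n.+2) * X - psy ^+ n.+2 * (X - Y))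
     <= w * (2^-1 * psy ^+ n.+2 * (b / z k) `^ q + C).
  apply: (@le_trans _ _ (w * (16 * N ^+ 2 / c * psy ^+ n * A))); last first.
    by rewrite ler_wpM2l // absorb // y0.
  apply: (@le_trans _ _ (psy ^+ n * ((N * L * w) ^+ 2 / kp))); last first.
    rewrite (_ : w * _ = psy ^+ n * (16 * N ^+ 2 / c * A * w)); last by ring.
    by rewrite ler_wpM2l.
  apply: le_trans square.
  rewrite (_ : 2 * _ * D - _ =
    D * (N * psy ^+ n.+1 * (L * w) * 2 - psy ^+ n.+2 * (kp * D))); last by ring.
  rewrite ler_wpM2l ?(ltW D0) //; apply: lerB; last by rewrite ler_wpM2l.
  apply: ler_pM => //; first by rewrite subr_ge0.
  exact: le_trans Xb1.
have scale : z k * (w * (b / z k) `^ q) = b `^ q.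
  by rewrite wE powR_rescale.
have jump : (b - a) * (psx ^+ n.+2 * X - psy ^+ n.+2 * Y) =
    - (z k * (D * ((psy ^+ n.+2 - psx ^+ n.+2) * X - psy ^+ n.+2 * (X - Y)))).
  by rewrite /D; field; exact: lt0r_neq0.
rewrite jump lerN2.
apply: (@le_trans _ _ (z k * (w * (2^-1 * psy ^+ n.+2 * (b / z k) `^ q + C)))).
  by rewrite ler_wpM2l // ltW.
by rewrite -scale le_eqVlt; apply/orP; left; apply/eqP; ring.
Qed.

End ConcaveTest.

(** * Finite sums and integration by parts on the graph *)

Lemma fsum_seq (R : realType) (V : choiceType) (A : set V) (B : seq V)
    (F : V -> R) :
  uniq B -> A `<=` [set` B] -> (forall x, ~ A x -> F x = 0) ->
  \sum_(x \in A) F x = \sum_(x <- B) F x.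
Proof.
move=> uB AB F0; rewrite [RHS]fsbig_seq //; apply: fsbig_widen => //.
by move=> x [_ /F0].
Qed.

Section Graph.
Context {R : realType} {V : choiceType} (G : weighted_graph R V).

Lemma gdist_walk x y : walk_of_length G x y (gdist G x y).
Proof. by rewrite /gdist; case: ex_minnP => m /asboolP. Qed.

Lemma gdist_le x y n : walk_of_length G x y n -> (gdist G x y <= n)%N.
Proof.
move=> w; rewrite /gdist; case: ex_minnP => m _; apply; exact/asboolP.
Qed.

Lemma gdistxx x : gdist G x x = 0%N.
Proof. by apply/eqP; rewrite -leqn0; apply: gdist_le; exists [::]. Qed.

Lemma gdist_adj o x y : adj G x y -> (gdist G o y <= (gdist G o x).+1)%N.
Proof.
move=> xy; have [p [pp pl ps]] := gdist_walk o x.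
apply: gdist_le; exists (rcons p y); split.
- by rewrite rcons_path pp pl.
- by rewrite last_rcons.
- by rewrite size_rcons ps.
Qed.

Lemma gball_finite o n : finite_set (gball G o n).
Proof.
elim: n => [|n IH].
  apply: (@sub_finite_set _ _ [set o]) => // x; rewrite /gball /= leqn0 => /eqP d.
  by have := gdist_walk o x; rewrite d => -[[|z p] [_ /= <- //]].
apply: (@sub_finite_set _ _
   (gball G o n `|` \bigcup_(x in gball G o n) [set y | adj G x y])).
  move=> y; rewrite /gball /= leq_eqVlt => /orP[/eqP d|]; last by left.
  right; have := gdist_walk o y; rewrite d => -[p []].
  case/lastP: p => [//|p z]; rewrite rcons_path last_rcons size_rcons.
  move=> /andP[pp lz] <- [ps]; exists (last o p) => //=.
  by rewrite -ps; apply: gdist_le; exists p.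
rewrite finite_setU; split => //; apply: bigcup_finite => // x _.
exact: adj_locally_finite.
Qed.

(** Without neighbours, connectedness would force x to be the only vertex. *)
Lemma exists_neighbour x : exists y, adj G x y.
Proof.
apply: contrapT => noy; apply: (@vertex_infinite _ _ G).
apply: (@sub_finite_set _ _ [set x]) => // y _ /=.
have [[|z p] [/= pp py]] := adj_connected G x y; first by rewrite py.
by case/andP: pp => xz _; case: noy; exists z.
Qed.

Lemma weight_ge0 x y : 0 <= weight G x y.
Proof.
have [xy|xy] := boolP (adj G x y); last by rewrite weight_nadj.
exact/ltW/weight_adj.
Qed.

Lemma vertex_measure_seq B x : uniq B -> (forall y, adj G x y -> y \in B) ->
  vertex_measure G x = \sum_(y <- B) weight G x y.
Proof.
move=> uB xB; apply: fsum_seq => // y /= xy.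
by apply: weight_nadj; exact/negP.
Qed.

Let neighbours x : seq V := enum_fset (fset_set [set y | adj G x y]).

Let mem_neighbours x y : (y \in neighbours x) = adj G x y.
Proof.
rewrite /neighbours in_fset_set; last exact: adj_locally_finite.
by apply/idP/idP => [/set_mem|xy] //; exact: mem_set.
Qed.

Lemma vertex_measure_gt0 x : 0 < vertex_measure G x.
Proof.
have [y xy] := exists_neighbour x.
have uN : uniq (neighbours x) by exact: fset_uniq.
rewrite (vertex_measure_seq uN); last by move=> z; rewrite mem_neighbours.
rewrite (bigD1_seq y) ?mem_neighbours //= ltr_pwDl ?weight_adj //.
by apply: sumr_ge0 => z _; exact: weight_ge0.
Qed.

Lemma vertex_measure_ge0 x : 0 <= vertex_measure G x.
Proof. exact/ltW/vertex_measure_gt0. Qed.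

Lemma sum_weight_le B x : uniq B ->
  \sum_(y <- B) weight G x y <= vertex_measure G x.
Proof.
move=> uB; pose C := undup (B ++ neighbours x).
rewrite (@vertex_measure_seq C) ?undup_uniq //; last first.
  by move=> y xy; rewrite mem_undup mem_cat mem_neighbours xy orbT.
have CB : perm_eq [seq y <- C | y \in B] B.
  apply: uniq_perm; rewrite ?filter_uniq ?undup_uniq // => y.
  by rewrite mem_filter mem_undup mem_cat; case: (y \in B).
rewrite -(perm_big _ CB) big_filter [leRHS](bigID (mem B)) /= lerDl.
by apply: sumr_ge0 => y _; exact: weight_ge0.
Qed.

Lemma laplacian_seq B (f : V -> R) x : uniq B ->
  (forall y, adj G x y -> y \in B) ->
  vertex_measure G x * laplacian G f x =
  \sum_(y <- B) weight G x y * (f y - f x).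
Proof.
move=> uB xB; rewrite mulVKf ?gt_eqF ?vertex_measure_gt0 //.
apply: fsum_seq => // y /= xy.
by rewrite weight_nadj ?mul0r //; exact/negP.
Qed.

Lemma set_measure_seq B o n : uniq B -> gball G o n `<=` [set` B] ->
  set_measure G (gball G o n) =
  \sum_(x <- B | (gdist G o x <= n)%N) vertex_measure G x.
Proof.
move=> uB nB; rewrite big_mkcond /=.
rewrite -(@fsum_seq _ _ (gball G o n)) //.
  by apply: eq_fsbigr => x /set_mem; rewrite /gball /= => ->.
by move=> x /negP/negbTE ->.
Qed.

(** Discrete integration by parts: swapping the two ends in the double sum of
    weight G x y * (f x * (u y - u x)) and averaging turns it into a sum over
    edges of (u y - u x) * (f x - f y) / 2. Bounding each edge by g at both of
    its ends costs at most the vertex measure times g. *)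
Lemma energy_lower_bound (B : seq V) (f u g : V -> R) : uniq B ->
  (forall x y, adj G x y ->
     - (g x + g y) <= (u y - u x) * (f x - f y)) -> (forall x, 0 <= g x) ->
  - \sum_(x <- B) vertex_measure G x * g x <=
  \sum_(x <- B) f x * \sum_(y <- B) weight G x y * (u y - u x).
Proof.
move=> uB edge g0.
pose T x y := weight G x y * (f x * (u y - u x)).
have SE : \sum_(x <- B) f x * (\sum_(y <- B) weight G x y * (u y - u x)) =
    \sum_(x <- B) \sum_(y <- B) T x y.
  apply: eq_bigr => x _; rewrite mulr_sumr; apply: eq_bigr => y _.
  by rewrite /T mulrCA.
have SC : \sum_(x <- B) \sum_(y <- B) T x y =
    \sum_(x <- B) \sum_(y <- B) T y x by rewrite exchange_big.
pose M x y := weight G x y * g y.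
have MC : \sum_(x <- B) \sum_(y <- B) M x y =
    \sum_(x <- B) \sum_(y <- B) M y x by rewrite exchange_big.
have MB : \sum_(x <- B) \sum_(y <- B) M y x <=
    \sum_(x <- B) vertex_measure G x * g x.
  apply: ler_sum => x _.
  rewrite -mulr_suml ler_wpM2r // (le_trans _ (sum_weight_le x uB)) //.
  by apply: ler_sum => y _; rewrite weight_sym.
have key : - (\sum_(x <- B) \sum_(y <- B) (M x y + M y x)) <=
    \sum_(x <- B) \sum_(y <- B) (T x y + T y x).
  rewrite -sumrN; apply: ler_sum => x _; rewrite -sumrN; apply: ler_sum => y _.
  rewrite /M /T (weight_sym G y x).
  have [xy|xy] := boolP (adj G x y); last first.
    by rewrite weight_nadj // !mul0r !addr0 oppr0.
  rewrite -!mulrDr -mulrN ler_wpM2l ?weight_ge0 //.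
  by have := edge _ _ xy; lra.
move: key; under eq_bigr do rewrite big_split /=.
rewrite big_split /= -MC; under [leRHS]eq_bigr do rewrite big_split /=.
rewrite big_split /= -SC SE; move: MB; rewrite -MC; lra.
Qed.

End Graph.

(** * Cut-off functions of d(o, x)^2 + t and one unit of time *)

Lemma sqrn_gap (d e : nat) : (e <= d.+1)%N -> (e ^ 2 <= d ^ 2 + (2 * d).+1)%N.
Proof.
move=> ed; apply: (@leq_trans (d.+1 ^ 2)); first by rewrite leq_exp2r.
by rewrite -addn1 sqrnD exp1n muln1 -addnA add1n.
Qed.

Lemma leq_sqrn (d : nat) : (d <= d ^ 2)%N.
Proof. by case: d => // d; rewrite expnS expn1 leq_pmulr. Qed.

Lemma sqrn_odd_le (d m : nat) : ((2 * d).+1 ^ 2 <= 8 * (d ^ 2 + m).+1)%N.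
Proof.
rewrite -[(2 * d).+1]addn1 sqrnD exp1n expnMn.
have := leq_sqrn d; move: (d ^ 2)%N => D; lia.
Qed.

Lemma is_derive_sum_seq (R : realType) (I : Type) (B : seq I)
    (f : I -> R -> R) (df : I -> R) (t : R) :
  (forall i, is_derive t 1 (f i) (df i)) ->
  is_derive t 1 (fun s => \sum_(i <- B) f i s) (\sum_(i <- B) df i).
Proof.
move=> fdf; elim: B => [|i B IH].
  rewrite big_nil (_ : (fun _ => _) = cst 0); first exact: is_derive_cst.
  by apply/funext => s; rewrite big_nil.
rewrite big_cons (_ : (fun _ => _) = f i + (fun s => \sum_(j <- B) f j s)).
  exact: is_deriveD.
by apply/funext => s; rewrite big_cons fctE.
Qed.

(** The power w M ^ (q / (q - 1)) with the conjugate exponent of q, written so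
    that it vanishes with w M. *)
Definition error_weight (R : realType) (w : nat -> R) (q : R) (M : nat) : R :=
  w M * w M `^ (q - 1)^-1.

Section Cutoff.
Context {R : realType} (w : nat -> R).

(** The piecewise linear function of M + s with value 1 at 0 and slope - w M on
    the interval [M, M + 1]. *)
Definition cutoff (M : nat) (s : R) : R := 1 - \sum_(i < M) w i - s * w M.

Hypothesis w_ge0 : forall M, 0 <= w M.
Hypothesis w_le1 : forall M, \sum_(i < M) w i <= 1.
Hypothesis w_anti : forall i j, (i <= j)%N -> w j <= w i.

Lemma cutoff1 M : cutoff M 1 = cutoff M.+1 0.
Proof. by rewrite /cutoff big_ord_recr /=; ring. Qed.

Lemma cutoff_bounds M (s : R) : 0 <= s <= 1 -> 0 <= cutoff M s <= 1.
Proof.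
move=> /andP[s0 s1]; have := w_le1 M.+1; rewrite big_ord_recr /= => H.
have S0 : 0 <= \sum_(i < M) w i by exact: sumr_ge0.
have := w_ge0 M; rewrite /cutoff => wM.
have : s * w M <= w M by rewrite ler_piMl.
have : 0 <= s * w M by rewrite mulr_ge0.
by lra.
Qed.

(** Since w is nonincreasing, the cut-off is convex: its variation between M and
    N is bounded by the slope at the left end M. *)
Lemma cutoff_diff M N (s : R) : (M <= N)%N -> 0 <= s <= 1 ->
  0 <= cutoff M s - cutoff N s <= (N - M)%:R * w M.
Proof.
move=> MN /andP[s0 s1].
have E k : \sum_(i < M + k) w i = \sum_(i < M) w i + \sum_(i < k) w (M + i)%N.
  by rewrite big_split_ord.
rewrite -(subnKC MN) addKn; move: (N - M)%N => k.
rewrite /cutoff E opprD !opprB.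
have Sk : \sum_(i < k) w (M + i)%N <= k%:R * w M.
  rewrite (_ : k%:R * w M = \sum_(i < k) w M).
    by apply: ler_sum => i _; apply: w_anti; rewrite leq_addr.
  by rewrite sumr_const card_ord mulr_natl.
have Sk0 : w M <= \sum_(i < k) w (M + i)%N + w (M + k)%N.
  case: k {E Sk} => [|k]; first by rewrite big_ord0 add0r addn0.
  rewrite big_ord_recl /= addn0 -addrA lerDl; apply: addr_ge0 => //.
  exact: sumr_ge0.
have wk : w (M + k)%N <= w M by apply: w_anti; rewrite leq_addr.
have H1 : s * w (M + k)%N <= s * w M by rewrite ler_wpM2l.
have H2 : s * (w M - w (M + k)%N) <= w M - w (M + k)%N.
  by rewrite ler_piMl // subr_ge0.
move: (\sum_(i < k) _) (\sum_(i < M) _) Sk Sk0 => S T.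
by lra.
Qed.

End Cutoff.

(** In this section M stands for d(o, x)^2 + m with m an integer time. Between m
    and m + 1 the cut-off at every vertex is affine in time, so that the
    weighted mass is differentiable there. *)
Section TimeStep.
Context {R : realType} {V : choiceType} (G : weighted_graph R V) (o : V).
Context (q c C : R) (n K L : nat) (dl z w : nat -> R) (B : seq V).

Let d2 x : nat := (gdist G o x ^ 2)%N.
Let p : nat := n.+2.
Let F := concave_test c K dl z.
Let F' := concave_slope c K dl z.

Definition weighted_mass (v : V -> R) (m : nat) (s : R) : R :=
  \sum_(x <- B) vertex_measure G x * (F (v x) * cutoff w (d2 x + m) s ^+ p).

Hypothesis q1 : 1 < q.
Hypothesis c01 : 0 < c < 1.
Hypothesis n0 : (0 < n)%N.
Hypothesis C0 : 0 <= C.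
Hypothesis absorb : forall s p : R, 0 <= s -> 0 <= p <= 1 ->
     16 * n.+2%:R ^+ 2 / c * p ^+ n * (1 + s) `^ (1 + c) <=
     2^-1 * p ^+ n.+2 * s `^ q + C.
Hypothesis dl_ge0 : forall k, 0 <= dl k.
Hypothesis dl_le1 : \sum_(k < K) dl k <= 1.
Hypothesis z_gt0 : forall k, 0 < z k.
Hypothesis w_ge0 : forall M, 0 <= w M.
Hypothesis w_le1 : forall M, \sum_(i < M) w i <= 1.
Hypothesis w_anti : forall i j, (i <= j)%N -> w j <= w i.
Hypothesis w_end : forall M, (L <= M)%N -> \sum_(i < M) w i = 1 /\ w M = 0.
Hypothesis w_level : forall M, 0 < w M -> exists2 k, (k < K)%N &
  [/\ w M = z k `^ (q - 1), 0 < dl k & M.+1%:R * w M <= 2 * dl k].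
Hypothesis uB : uniq B.
Hypothesis B_ball : gball G o L.+1 `<=` [set` B].

Let e := error_weight w q.

Let e_level M k : w M = z k `^ (q - 1) -> e M = w M * z k.
Proof.
move=> E; rewrite /e /error_weight {2}E -powRrM divff ?powRr1 ?(ltW (z_gt0 k)) //.
by rewrite gt_eqF // subr_gt0.
Qed.

Let e_ge0 M : 0 <= e M. Proof. by rewrite /e mulr_ge0 ?powR_ge0. Qed.

Let absorbed_ge0 (Y a : R) : 0 <= Y -> 0 <= 2^-1 * Y ^+ p * a `^ q.
Proof.
by move=> Y0; apply: mulr_ge0 (powR_ge0 _ _); apply: mulr_ge0 (exprn_ge0 _ Y0).
Qed.

Let cutoff_end M (s : R) : (L <= M)%N -> cutoff w M s = 0.
Proof. by move=> /w_end[S wM]; rewrite /cutoff S wM; ring. Qed.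

(** [edge_inequality] applies because d(o, x)^2 varies by at most 2 d(o, y) + 1
    along an edge, and the square of this number is at most of order M + 1. *)
Let edge_step (v : V -> R) m (s : R) x y : (forall x, 0 <= v x) -> 0 <= s <= 1 ->
  adj G x y -> (gdist G o y <= gdist G o x)%N ->
  - (2^-1 * cutoff w (d2 y + m) s ^+ p * v y `^ q + C * e (d2 y + m)) <=
  (v y - v x) * (cutoff w (d2 x + m) s ^+ p * F' (v x) -
                 cutoff w (d2 y + m) s ^+ p * F' (v y)).
Proof.
move=> v0 s01 xy dyx.
have dxy : (gdist G o x <= (gdist G o y).+1)%N.
  by apply: gdist_adj; rewrite adj_sym.
have d2yx : (d2 y + m <= d2 x + m)%N by rewrite leq_add2r /d2 leq_exp2r.
have [/andP[X0 X1] /andP[Y0 Y1]] := (cutoff_bounds w_ge0 w_le1 (d2 x + m) s01,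
   cutoff_bounds w_ge0 w_le1 (d2 y + m) s01).
have /andP[D0 D1] := cutoff_diff w_ge0 w_anti d2yx s01.
have dd : (d2 x + m - (d2 y + m))%:R <= ((2 * gdist G o y).+1%:R : R).
  by rewrite ler_nat /d2 subnDr leq_subLR sqrn_gap.
set M := (d2 y + m)%N in d2yx Y0 Y1 D0 D1 dd *.
have := w_ge0 M; rewrite le_eqVlt => /orP[/eqP wM|wM].
  have -> : cutoff w (d2 x + m) s = cutoff w M s.
    by move: D1; rewrite -wM mulr0; lra.
  rewrite /e /error_weight -wM mul0r mulr0 addr0 -mulrBr (mulrCA (v y - v x)).
  apply: (@le_trans _ _ 0).
    by rewrite oppr_le0 absorbed_ge0.
  rewrite mulr_ge0 ?exprn_ge0 //.
  have [vv|/ltW vv] := leP (v x) (v y).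
    by rewrite mulr_ge0 ?subr_ge0 //; apply: concave_slope_anti.
  by rewrite mulr_le0 ?subr_le0 //; apply: concave_slope_anti.
have [k kK [wk dk Mk]] := w_level wM.
rewrite (e_level wk).
apply: (@edge_inequality R c K dl z c01 dl_ge0 dl_le1 z_gt0 q n k C
  ((2 * gdist G o y).+1%:R)) => //; first last.
- by apply: le_trans D1 _; rewrite ler_wpM2r.
- by lra.
apply: (@le_trans _ _ (8 * (M.+1%:R * w M))); last by lra.
rewrite mulrA ler_wpM2r // -natrX -natrM ler_nat.
exact: sqrn_odd_le.
Qed.

(** The loss due to the time derivative of the cut-off; it has the same size as
    the loss on the edges. *)
Let time_term (a s : R) M : 0 <= a -> 0 <= s <= 1 ->
  F a * (p%:R * cutoff w M s ^+ p.-1 * w M) <=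
  2^-1 * cutoff w M s ^+ p * a `^ q + C * e M.
Proof.
move=> a0 s01; have /andP[Y0 Y1] := cutoff_bounds w_ge0 w_le1 M s01.
have := w_ge0 M; rewrite le_eqVlt => /orP[/eqP wM|wM].
  rewrite -wM !mulr0 /e /error_weight -wM mul0r mulr0 addr0.
  exact: absorbed_ge0.
have [k kK [wk dk _]] := w_level wM.
rewrite (e_level wk); have zk := z_gt0 k.
set Y := cutoff w M s in Y0 Y1 *.
have az : 0 <= a / z k by rewrite divr_ge0 // ltW.
have Y01 : 0 <= Y <= 1 by rewrite Y0.
have := absorb az Y01.
have /andP[_ Fa] := concave_test_bounds c01 dl_ge0 dl_le1 z_gt0 a0.
have scale : z k * (w M * (a / z k) `^ q) = a `^ q.
  by rewrite wk powR_rescale.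
have C0' : 2 * p%:R <= 16 * n.+2%:R ^+ 2 / c.
  have /andP[c0 c1] := c01.
  rewrite ler_pdivlMr //; have : (1 : R) <= p%:R by rewrite ler1n.
  by rewrite -/p; move: (p%:R : R) => P P1; nra.
have s1 : a / z k <= (1 + a / z k) `^ (1 + c).
  have /andP[c0 c1] := c01.
  apply: (@le_trans _ _ (1 + a / z k)); first by lra.
  by apply: le1r_powR; lra.
have YY : Y ^+ n.+1 <= Y ^+ n by rewrite exprS ler_piMl // exprn_ge0.
move=> H.
have H1 : 2 * p%:R * Y ^+ n.+1 * (a / z k) <= 2^-1 * Y ^+ p * (a / z k) `^ q + C.
  apply: le_trans H; apply: ler_pM => //.
    by rewrite mulr_ge0 // exprn_ge0.
  by apply: ler_pM => //; rewrite exprn_ge0.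
apply: (@le_trans _ _ (2 * a * (p%:R * Y ^+ p.-1 * w M))).
  by rewrite ler_wpM2r // mulr_ge0 // mulr_ge0 // exprn_ge0.
have -> : 2 * a * (p%:R * Y ^+ p.-1 * w M) =
   w M * z k * (2 * p%:R * Y ^+ n.+1 * (a / z k)).
  by rewrite /p /=; field; exact: lt0r_neq0.
have -> : 2^-1 * Y ^+ p * a `^ q + C * (w M * z k) =
   w M * z k * (2^-1 * Y ^+ p * (a / z k) `^ q + C).
  by rewrite -scale; ring.
by rewrite ler_wpM2l // mulr_ge0 // ltW.
Qed.

(** The reaction term F' u^q psi^p is at least u^q psi^p; one half of it absorbs
    the loss on the edges and the other half the loss of [time_term]. *)
Lemma mass_derivative_lower_bound (v : V -> R) m (s : R) :
  (forall x, 0 <= v x) -> 0 <= s <= 1 ->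
  - \sum_(x <- B) vertex_measure G x * (2 * C * e (d2 x + m)) <=
  \sum_(x <- B) vertex_measure G x *
    (F' (v x) * (laplacian G v x + v x `^ q) * cutoff w (d2 x + m) s ^+ p -
     F (v x) * (p%:R * cutoff w (d2 x + m) s ^+ p.-1 * w (d2 x + m))).
Proof.
move=> v0 s01.
pose ps x := cutoff w (d2 x + m) s.
have ps0 x : 0 <= ps x by case/andP: (cutoff_bounds w_ge0 w_le1 (d2 x + m) s01).
pose g x := 2^-1 * ps x ^+ p * v x `^ q + C * e (d2 x + m).
pose f x := ps x ^+ p * F' (v x).
have g0 x : 0 <= g x.
  apply: addr_ge0; last by rewrite mulr_ge0.
  exact: absorbed_ge0.
have edge x y : adj G x y -> - (g x + g y) <= (v y - v x) * (f x - f y).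
  move=> xy; case: (leqP (gdist G o y) (gdist G o x)) => [h|/ltnW h].
    apply: le_trans (edge_step m v0 s01 xy h).
    by rewrite lerN2 -/(ps y) -/(g y) lerDr.
  have yx : adj G y x by rewrite adj_sym.
  rewrite (_ : (v y - v x) * (f x - f y) = (v x - v y) * (f y - f x)); last by ring.
  apply: le_trans (edge_step m v0 s01 yx h).
  by rewrite lerN2 -/(ps x) -/(g x) lerDl.
have E := energy_lower_bound uB edge g0.
have T : \sum_(x <- B) f x * (\sum_(y <- B) weight G x y * (v y - v x)) =
    \sum_(x <- B) vertex_measure G x * (F' (v x) * laplacian G v x * ps x ^+ p).
  (* a vertex with a neighbour outside B is out of the support of the cut-off *)
  apply: eq_bigr => x _; have [h|h] := leqP L (d2 x + m).
    by rewrite /f /ps cutoff_end // expr0n /= !(mul0r, mulr0).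
  rewrite -(@laplacian_seq _ _ G B v) // /f; first by ring.
  move=> y xy; apply: B_ball; rewrite /gball /=.
  apply: leq_trans (gdist_adj o xy) _; rewrite ltnS.
  apply: leq_trans (ltnW h); apply: leq_trans (leq_addr _ _); exact: leq_sqrn.
rewrite T in E.
apply: (@le_trans _ _ (- \sum_(x <- B) vertex_measure G x * g x +
   \sum_(x <- B) vertex_measure G x * (ps x ^+ p * v x `^ q - g x))).
  rewrite -!sumrN -big_split /=; apply: ler_sum => x _.
  by rewrite /g le_eqVlt; apply/orP; left; apply/eqP; field.
apply: le_trans (lerD E (lexx _)) _.
rewrite -big_split /=; apply: ler_sum => x _.
rewrite -mulrDr ler_wpM2l ?vertex_measure_ge0 //.
rewrite mulrDr mulrDl -/(ps x) -addrA lerD2l; apply: lerB.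
  rewrite mulrC -mulrA ler_peMl //; last exact: concave_slope_ge1.
  by rewrite mulr_ge0 ?powR_ge0 // exprn_ge0.
exact: time_term.
Qed.

Lemma mass_step (v : R -> V -> R) m :
  (forall (s : R) x, 0 <= s <= 1 -> 0 <= v s x) ->
  (forall (s : R) x, 0 <= s <= 1 ->
     is_derive s 1 (v ^~ x) (laplacian G (v s) x + v s x `^ q)) ->
  weighted_mass (v 0) m 0 <= weighted_mass (v 1) m 1 +
    \sum_(x <- B) vertex_measure G x * (2 * C * e (d2 x + m)).
Proof.
move=> v0 dv.
pose J (s : R) := weighted_mass (v s) m s.
pose dJ (s : R) := \sum_(x <- B) vertex_measure G x *
    (F' (v s x) * (laplacian G (v s) x + v s x `^ q) * cutoff w (d2 x + m) s ^+ p -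
     F (v s x) * (p%:R * cutoff w (d2 x + m) s ^+ p.-1 * w (d2 x + m))).
have dJP (s : R) : 0 <= s <= 1 -> is_derive s 1 J (dJ s).
  move=> s01; apply: is_derive_sum_seq => x.
  have H1 : is_derive s 1 (F \o (v ^~ x))
      (F' (v s x) * (laplacian G (v s) x + v s x `^ q)).
    apply: is_derive1_comp; last exact: dv.
    by apply: is_derive_concave_test => //; exact: v0.
  pose h := cst (1 - \sum_(i < d2 x + m) w i) - w (d2 x + m)%N \*: (@id R).
  have hE (t : R) : cutoff w (d2 x + m) t = h t.
    by rewrite /h /cutoff !fctE /= /GRing.scale /= mulrC.
  have H2 : is_derive s 1 h (- w (d2 x + m)%N).
    by apply: is_derive_eq; rewrite sub0r scaler1.
  rewrite (_ : (fun _ => _) = vertex_measure G x \*: ((F \o (v ^~ x)) * h ^+ p)).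
    apply: is_derive_eq; rewrite /GRing.scale /= !fctE hE /=; ring.
  by apply/funext => t; rewrite /GRing.scale /= !fctE hE.
have [||t t01] := @MVT_segment R J dJ 0 1 ler01.
- by move=> t; rewrite in_itv /= => /andP[/ltW ? /ltW ?]; apply/dJP/andP.
- apply: derivable_within_continuous => t; rewrite in_itv /= => /dJP H.
  exact: ex_derive.
rewrite subr0 mulr1 /J => E.
have := @mass_derivative_lower_bound (v t) m t (fun x => v0 t x t01) t01.
by rewrite -/(dJ t) -E; lra.
Qed.

End TimeStep.

(** * The slope of the cut-off, made of dyadic blocks *)

Lemma telescope_le (R : realType) (f g : nat -> R) :
  (forall m, f m <= f m.+1 + g m) -> forall N, f 0%N <= f N + \sum_(m < N) g m.
Proof.
move=> step; elim=> [|N IH]; first by rewrite big_ord0 addr0.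
by rewrite big_ord_recr /=; have := step N; lra.
Qed.

Lemma sum_shift_le (R : realType) (e : nat -> R) (L a : nat) :
  (forall M, 0 <= e M) -> (forall M, (L <= M)%N -> e M = 0) ->
  \sum_(m < L) e (a + m)%N <= \sum_(M < L | (a <= M)%N) e M.
Proof.
move=> e0 eL.
have -> : \sum_(m < L) e (a + m)%N = \sum_(0 <= M < a + L | (a <= M)%N) e M.
  rewrite (@big_cat_nat _ _ _ a) ?leq_addr //= big_nat_cond [X in X + _]big_pred0 ?add0r.
    rewrite (_ : \sum_(a <= i < a + L | (a <= i)%N) e i =
        \sum_(0 + a <= i < a + L | (a <= i)%N) e i) // big_addn addKn big_mkord.
    by apply: eq_big => [i|i _]; rewrite ?leq_addl // addnC.
  by move=> i; rewrite /=; case: (ltnP i a) => //; rewrite andbF.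
rewrite addnC (@big_cat_nat _ _ _ L) ?leq_addr //= [X in _ + X]big_nat_cond.
rewrite [X in _ + X]big1 ?addr0 ?big_mkord // => i /andP[/andP[+ _] _].
exact: eL.
Qed.

Lemma weighted_sum_shift_le (R : realType) (V : Type) (B : seq V)
    (mass : V -> R) (a : V -> nat) (e : nat -> R) (L : nat) :
  (forall x, 0 <= mass x) ->
  (forall M, 0 <= e M) -> (forall M, (L <= M)%N -> e M = 0) ->
  \sum_(m < L) \sum_(x <- B) mass x * e (a x + m)%N <=
  \sum_(M < L) e M * \sum_(x <- B | (a x <= M)%N) mass x.
Proof.
move=> mass0 e0 eL; rewrite exchange_big /=.
under [leRHS]eq_bigr do rewrite mulr_sumr.
rewrite [leRHS](exchange_big_dep xpredT) //=; apply: ler_sum => x _.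
rewrite -mulr_sumr; apply: (le_trans (ler_wpM2l (mass0 x) (sum_shift_le (a x) e0 eL))).
by rewrite mulr_sumr; apply: ler_sum => M _; rewrite mulrC.
Qed.

(** The slope is constant on the blocks 4 ^ k <= M + 1 < 4 ^ k.+1, that is, on
    the dyadic annuli of the parabolic distance, and has total mass one. *)
Section Profile.
Context {R : realType} (om : nat -> R) (K : nat).
Hypothesis om_gt0 : forall k, 0 < om k.
Hypothesis om_anti : forall i j, (i <= j)%N -> om j <= om i.

Definition block_sum (m : nat) : R := \sum_(k < m) 3 * 4 ^+ k * om k.

Definition profile (M : nat) : R :=
  if (M.+1 < 4 ^ K)%N then om (trunc_log 4 M.+1) / block_sum K else 0.

Hypothesis K0 : (0 < K)%N.

Lemma block_sum_gt0 : 0 < block_sum K.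
Proof.
rewrite /block_sum -(prednK K0) big_ord_recl ltr_pwDl //.
  by rewrite !mulr_gt0 // exprn_gt0.
by apply: sumr_ge0 => k _; rewrite !mulr_ge0 ?exprn_ge0 // ltW.
Qed.

Lemma sum_blocks m : \sum_(i < (4 ^ m).-1) om (trunc_log 4 i.+1) = block_sum m.
Proof.
elim: m => [|m IH]; first by rewrite /block_sum !big_ord0.
have p4 : (0 < 4 ^ m)%N by rewrite expn_gt0.
have -> : (4 ^ m.+1).-1 = ((4 ^ m).-1 + 3 * 4 ^ m)%N by rewrite expnS; lia.
rewrite big_split_ord /= IH /block_sum big_ord_recr /=; congr (_ + _).
rewrite (eq_bigr (fun _ => om m)).
  by rewrite sumr_const card_ord -(mulr_natl (om m)) natrM natrX.
move=> i _; congr om; apply: trunc_log_eq => //.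
have := ltn_ord i; rewrite expnS; lia.
Qed.

Lemma profile_ge0 M : 0 <= profile M.
Proof.
by rewrite /profile; case: ifP => // _; rewrite divr_ge0 ?ltW ?block_sum_gt0.
Qed.

Lemma profile_anti i j : (i <= j)%N -> profile j <= profile i.
Proof.
move=> ij; rewrite {1}/profile; case: ifP => jK; last exact: profile_ge0.
rewrite /profile (leq_ltn_trans _ jK) ?ltnS //.
by rewrite ler_pM2r ?invr_gt0 ?block_sum_gt0 // om_anti // leq_trunc_log.
Qed.

Lemma profile_end M : (4 ^ K <= M)%N ->
  \sum_(i < M) profile i = 1 /\ profile M = 0.
Proof.
move=> KM; have p4 : (0 < 4 ^ K)%N by rewrite expn_gt0.
split; last by rewrite /profile ltnNge (leq_trans KM).
have -> : M = ((4 ^ K).-1 + (M - (4 ^ K).-1))%N by lia.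
rewrite big_split_ord /= [X in _ + X]big1 ?addr0; last first.
  by move=> i _; rewrite /profile ifF //; apply/negbTE; rewrite -leqNgt; lia.
rewrite (eq_bigr (fun i : 'I__ => om (trunc_log 4 i.+1) / block_sum K)).
  by rewrite -mulr_suml sum_blocks divff // gt_eqF // block_sum_gt0.
by move=> i _; rewrite /profile ifT //; have := ltn_ord i; lia.
Qed.

Lemma profile_le1 M : \sum_(i < M) profile i <= 1.
Proof.
have [|<- _] := @profile_end (M + 4 ^ K); first exact: leq_addl.
by rewrite big_split_ord /= lerDl; apply: sumr_ge0 => i _; exact: profile_ge0.
Qed.

Lemma profile_gt0 M : 0 < profile M -> exists2 k, (k < K)%N &
  profile M = om k / block_sum K /\ (M.+1 < 4 ^ k.+1)%N.
Proof.
rewrite /profile; case: ifP => [MK _|_]; last by rewrite ltxx.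
exists (trunc_log 4 M.+1); last by split => //; exact: trunc_log_ltn.
rewrite -(@ltn_exp2l 4) //; apply: leq_ltn_trans MK; exact: trunc_logP.
Qed.

End Profile.

(** Dyadic condensation: the terms with 2 ^ k.+1 <= n < 2 ^ k.+2 sum to at most
    8 * 4 ^ k times the k-th level, because the volume is nondecreasing. *)
Lemma condensation_unbounded (R : realType) (vol : nat -> R) (r : R) :
  0 <= r -> (forall n, 0 < vol n) ->
  (forall m n, (m <= n)%N -> vol m <= vol n) ->
  (\sum_(1 <= n <oo) (n%:R / vol n `^ r)%:E = +oo)%E ->
  forall A : R, exists2 K, (0 < K)%N &
    A <= block_sum (fun k => (vol (2 ^ k.+1)%N `^ r)^-1) K.
Proof.
move=> r0 vol0 volm div A; apply: contrapT => noK.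
set om : nat -> R := fun k => (_ `^ r)^-1 in noK.
pose f n : R := n%:R / vol n `^ r.
have f0 n : 0 <= f n by rewrite divr_ge0 ?powR_ge0.
have om0 k : 0 < om k by rewrite invr_gt0 powR_gt0.
have step K : \sum_(1 <= n < 2 ^ K.+1) f n <= f 1%N + 8 / 3 * block_sum om K.
  elim: K => [|K IH].
    by rewrite expn1 big_nat1 /block_sum big_ord0 mulr0 addr0.
  rewrite (@big_cat_nat _ _ _ (2 ^ K.+1)) ?expn_gt0 ?leq_exp2l //=.
  rewrite /block_sum big_ord_recr /= mulrDr addrA; apply: lerD => //.
  apply: (@le_trans _ _ (\sum_(2 ^ K.+1 <= n < 2 ^ K.+2) (2 ^ K.+2)%:R * om K)).
    apply: ler_sum_nat => n /andP[n1 n2]; apply: ler_pM => //.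
    - by rewrite invr_ge0 powR_ge0.
    - by rewrite ler_nat ltnW.
    - rewrite lef_pV2 ?posrE ?powR_gt0 //; apply: ge0_ler_powR => //.
      + by rewrite nnegrE ltW.
      + by rewrite nnegrE ltW.
      + exact: volm.
  rewrite sumr_const_nat -[leLHS]mulr_natl mulrA.
  rewrite (_ : 8 / 3 * _ = 8 * 4 ^+ K * om K); last by field.
  rewrite ler_wpM2r ?(ltW (om0 K)) //.
  rewrite (_ : (2 ^ K.+2 - 2 ^ K.+1 = 2 ^ K.+1)%N); last by rewrite expnS; lia.
  rewrite -natrM -expnD (_ : (K.+1 + K.+2 = 2 * K + 3)%N); last by lia.
  rewrite expnD expnM natrM natrX.
  by rewrite (_ : (2 ^ 3)%:R = 8 :> R) // (_ : (2 ^ 2)%:R = 4 :> R) //; lra.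
suff : (\sum_(1 <= n <oo) (f n)%:E <= (f 1%N + 8 / 3 * A)%:E)%E.
  by rewrite div leye_eq.
apply: lime_le.
  by apply: is_cvg_nneseries => n _ _; rewrite lee_fin.
apply: nearW => N; rewrite sumEFin lee_fin.
apply: (@le_trans _ _ (\sum_(1 <= n < 2 ^ N.+2) f n)).
  have NN : (N <= 2 ^ N.+2)%N.
    by apply: (@leq_trans (2 ^ N)); rewrite ?leq_exp2l // ltnW // ltn_expl.
  case: N NN => [|N] NN; first by rewrite big_geq // sumr_ge0.
  by rewrite [leRHS](@big_cat_nat _ _ _ N.+1) //= lerDl sumr_ge0.
apply: (le_trans (step _)); rewrite lerD2l ler_wpM2l //.
by apply/ltW; rewrite ltNge; apply/negP => AK; apply: noK; exists N.+1.
Qed.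

(** * Decay of solutions *)

Section BallVolume.
Context {R : realType} {V : choiceType} (G : weighted_graph R V) (o : V).

Definition ball_volume (n : nat) : R := set_measure G (gball G o n).

Lemma ball_seq n : exists2 B : seq V, uniq B & gball G o n `<=` [set` B].
Proof.
exists (enum_fset (fset_set (gball G o n))); first exact: fset_uniq.
by move=> x xB /=; rewrite in_fset_set ?mem_set //; exact: gball_finite.
Qed.

Lemma ball_volume_gt0 n : 0 < ball_volume n.
Proof.
have [B uB nB] := ball_seq n; rewrite /ball_volume (set_measure_seq uB nB).
have oB : o \in B by apply: nB; rewrite /gball /= gdistxx.
rewrite (big_rem o) //= gdistxx /= ltr_pwDl ?vertex_measure_gt0 //.
by apply: sumr_ge0 => x _; exact: vertex_measure_ge0.
Qed.

Lemma ball_volume_mono m n : (m <= n)%N -> ball_volume m <= ball_volume n.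
Proof.
move=> mn; have [B uB nB] := ball_seq n.
have mB : gball G o m `<=` [set` B].
  by move=> x xm; apply: nB; exact: leq_trans mn.
rewrite /ball_volume (set_measure_seq uB nB) (set_measure_seq uB mB).
rewrite big_mkcond [leRHS]big_mkcond; apply: ler_sum => x _ /=.
case: ifP => [xm|_]; first by rewrite (leq_trans xm).
by case: ifP => // _; exact: vertex_measure_ge0.
Qed.

Context (q : R) (q1 : 1 < q).

Definition level (k : nat) : R := (ball_volume (2 ^ k.+1) `^ (q - 1))^-1.

Lemma level_gt0 k : 0 < level k.
Proof. by rewrite invr_gt0 powR_gt0 // ball_volume_gt0. Qed.

Lemma level_anti i j : (i <= j)%N -> level j <= level i.
Proof.
move=> ij; rewrite lef_pV2 ?posrE ?powR_gt0 ?ball_volume_gt0 //.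
apply: ge0_ler_powR; rewrite ?nnegrE ?(ltW (ball_volume_gt0 _)) ?subr_ge0 ?(ltW q1) //.
by apply: ball_volume_mono; rewrite leq_exp2l.
Qed.

(** For each value M of d(o, x)^2 + m, the vertices involved lie in a ball of
    volume V with w M = V ^ (1 - q) / S, where S is the block sum. Hence
    w M ^ (q / (q - 1)) * V = w M * S ^ (- 1 / (q - 1)), and w has mass one. *)
Lemma error_bound (K : nat) (B : seq V) : (0 < K)%N -> uniq B ->
  gball G o (4 ^ K).+1 `<=` [set` B] ->
  \sum_(m < 4 ^ K) \sum_(x <- B) vertex_measure G x *
      error_weight (profile level K) q (gdist G o x ^ 2 + m)%N
    <= block_sum level K `^ (- (q - 1)^-1).
Proof.
move=> K0 uB BB; set w := profile level K; set e := error_weight w q; set S := block_sum level K.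
have S0 : 0 < S by apply: block_sum_gt0 => // k; exact: level_gt0.
have w0 M : 0 <= w M by apply: profile_ge0 => // k; exact: level_gt0.
have e0 M : 0 <= e M by rewrite /e mulr_ge0 // powR_ge0.
have wend M : (4 ^ K <= M)%N -> \sum_(i < M) w i = 1 /\ w M = 0.
  by apply: profile_end => // k; exact: level_gt0.
have eend M : (4 ^ K <= M)%N -> e M = 0.
  by move=> /wend[_ wM]; rewrite /e /error_weight wM mul0r.
apply: (le_trans (weighted_sum_shift_le _ _ (vertex_measure_ge0 G) e0 eend)).
have -> : S `^ (- (q - 1)^-1) = \sum_(M < 4 ^ K) w M * S `^ (- (q - 1)^-1).
  by have [S1 _] := wend _ (leqnn _); rewrite -mulr_suml S1 mul1r.
apply: ler_sum => M _; rewrite /e /error_weight -mulrA.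
have := w0 M; rewrite le_eqVlt => /orP[/eqP <-|wM]; first by rewrite !mul0r.
rewrite ler_wpM2l //.
have [k kK [wk Mk]] := profile_gt0 wM; rewrite -/w -/S in wk.
have V0 := ball_volume_gt0 (2 ^ k.+1).
have vol : \sum_(x <- B | (gdist G o x ^ 2 <= M)%N) vertex_measure G x <=
    ball_volume (2 ^ k.+1).
  rewrite /ball_volume (@set_measure_seq _ _ _ B) //; last first.
    move=> x; rewrite /gball /= => xk; apply: BB; rewrite /gball /=.
    apply: (leq_trans xk); apply: leqW.
    have -> : (4 ^ K = 2 ^ (2 * K))%N by rewrite expnM.
    by rewrite leq_exp2l // (leq_trans kK) // leq_pmull.
  rewrite big_mkcond [leRHS]big_mkcond; apply: ler_sum => x _ /=.
  case: ifP => [xM|_]; last by case: ifP => // _; exact: vertex_measure_ge0.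
  have k4 : ((2 ^ k.+1) ^ 2 = 4 ^ k.+1)%N by rewrite -expnM mulnC expnM.
  by rewrite ifT // -(@leq_exp2r _ _ 2) // k4 (leq_trans xM) // ltnW // ltnW.
have -> : w M `^ (q - 1)^-1 = S `^ (- (q - 1)^-1) / ball_volume (2 ^ k.+1).
  rewrite wk powRM ?(ltW (level_gt0 _)) ?invr_ge0 ?(ltW S0) //.
  rewrite /level -powRN -powRrM mulNr divff; last first.
    by rewrite subr_eq0 gt_eqF.
  rewrite powR_inv1 ?(ltW V0) // mulrC; congr (_ / _).
  by rewrite -powR_inv1 ?(ltW S0) // -powRrM mulN1r.
by rewrite mulrAC ler_pdivrMr // ler_wpM2l // powR_ge0.
Qed.

End BallVolume.

Section Decay.
Context {R : realType} {V : choiceType} (G : weighted_graph R V) (o : V).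
Context (q : R) (u : R -> V -> R).
Hypothesis q1 : 1 < q.
Hypothesis u_ge0 : forall (t : R) x, 0 < t -> 0 <= u t x.
Hypothesis u_C1 : forall x, C1_pos (u ^~ x).
Hypothesis u_heat : solves_heat G q u.

Lemma is_derive_solution (t : R) x : 0 < t ->
  is_derive t 1 (u ^~ x) (laplacian G (u t) x + u t x `^ q).
Proof.
move=> t0; have [du _] := u_C1 x t0; split; first exact: du.
by rewrite -derive1E -(u_heat x t0); ring.
Qed.

(** The weighted mass started at time t is at least the contribution of o, where
    the cut-off is 1. It vanishes after 4 ^ K units of time, and in between it
    decreases by no more than the errors summed in [error_bound]. *)
Lemma solution_decay : exists2 C : R, 0 <= C & forall (K : nat) (t : R),
  (0 < K)%N -> 0 < t -> vertex_measure G o * u t o <=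
  C * block_sum (level G o q) K `^ (- (q - 1)^-1).
Proof.
(* any exponent with 0 < c < 1 and 1 + c < q would do *)
pose c := (q - 1) / (q + 1).
have q10 : 0 < q + 1 by move: (q1); lra.
have c01 : 0 < c < 1.
  by rewrite divr_gt0 ?subr_gt0 //= ltr_pdivrMr //; move: (q1); lra.
have cq : 1 + c < q.
  by rewrite -ltrBrDl /c ltr_pdivrMr //; move: (q1); nra.
have [n n0 absorption] := power_absorption c01 cq.
have [|C C0 absorb] := absorption (16 * n.+2%:R ^+ 2 / c).
  by case/andP: c01 => c0 _; rewrite divr_gt0 // mulr_gt0 // exprn_gt0.
exists (2 * C); first by rewrite mulr_ge0.
move=> K t K0 t0.
set om := level G o q; pose w := profile om K; pose S := block_sum om K.
have om0 k : 0 < om k by exact: level_gt0.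
have oma i j : (i <= j)%N -> om j <= om i by exact: level_anti.
have S0 : 0 < S by exact: block_sum_gt0.
(* the decrease of the cut-off across the k-th block *)
pose dl k := 3 * 4 ^+ k * om k / S.
pose z k := (om k / S) `^ (q - 1)^-1.
have dl0 k : 0 < dl k by rewrite divr_gt0 // !mulr_gt0 // exprn_gt0.
have dl1 : \sum_(k < K) dl k <= 1.
  by rewrite -mulr_suml divff // gt_eqF.
have z0 k : 0 < z k by rewrite powR_gt0 // divr_gt0.
have w0 := profile_ge0 om0 K0; have w1 := profile_le1 om0 K0.
have wa := profile_anti om0 oma K0.
have we M : (4 ^ K <= M)%N -> \sum_(i < M) w i = 1 /\ w M = 0.
  exact: profile_end.
have [B uB BB] := ball_seq G o (4 ^ K).+1.
have wl M : 0 < w M -> exists2 k, (k < K)%N &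
    [/\ w M = z k `^ (q - 1), 0 < dl k & M.+1%:R * w M <= 2 * dl k].
  move=> wM; have [k kK [wk Mk]] := profile_gt0 wM.
  exists k => //; rewrite -/w -/S in wk; split => //.
    rewrite wk /z -powRrM mulVf ?subr_eq0 ?gt_eqF // powRr1 //.
    by apply: divr_ge0; exact: ltW.
  rewrite (_ : dl k = 3 * 4 ^+ k * w M); last by rewrite wk /dl; ring.
  rewrite mulrA ler_wpM2r //; apply: (@le_trans _ _ (4 * 4 ^+ k)).
    by rewrite -exprS -natrX ler_nat ltnW.
  have : 0 <= (4 : R) ^+ k by rewrite exprn_ge0.
  by lra.
pose I m := weighted_mass G o c n K dl z w B (u (t + m%:R)) m 0.
pose e := error_weight w q.
pose E m := \sum_(x <- B) vertex_measure G x * (2 * C * e (gdist G o x ^ 2 + m)%N).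
have step m : I m <= I m.+1 + E m.
  have tm s : 0 <= s <= 1 -> 0 < t + m%:R + s.
    by move=> /andP[s0 _]; rewrite ltr_wpDr // ltr_wpDr.
  have dlge k : 0 <= dl k by exact: ltW.
  have := @mass_step R V G o q c C n K (4 ^ K) dl z w B q1 c01 n0 C0 absorb
    dlge dl1 z0 w0 w1 wa we wl uB BB (fun s => u (t + m%:R + s)) m.
  rewrite addr0 -addrA -natr1 => H; apply: le_trans (H _ _) _.
  - by move=> s x /tm; exact: u_ge0.
  - move=> s x s01; have H1 := is_derive_solution x (tm s s01).
    pose g := cst (t + m%:R) + (@id R).
    have gE r : g r = t + m%:R + r by rewrite /g fctE.
    have H2 : is_derive s 1 g 1 by apply: is_derive_eq; rewrite add0r.
    rewrite -gE in H1.
    have := @is_derive1_comp R (u ^~ x) g s _ _ H1 H2; rewrite mulr1 gE.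
    by congr is_derive; apply/funext => r /=; rewrite gE.
  rewrite lerD2r le_eqVlt; apply/orP; left; apply/eqP.
  rewrite /I /weighted_mass; apply: eq_bigr => x _.
  by rewrite addnS cutoff1 natr1.
have tele := telescope_le step.
have pB x : 0 <= cutoff w (gdist G o x ^ 2 + 0) 0 <= 1.
  by apply: cutoff_bounds => //; rewrite lexx ler01.
have Iend : I (4 ^ K)%N = 0.
  rewrite /I /weighted_mass big1 // => x _; rewrite /cutoff.
  have [-> ->] := we _ (leq_addl (gdist G o x ^ 2) (4 ^ K)).
  by rewrite subrr mulr0 subrr expr0n /= !mulr0.
have Istart : vertex_measure G o * u t o <= I 0%N.
  have oB : o \in B by apply: BB; rewrite /gball /= gdistxx.
  have dlge k : 0 <= dl k by exact: ltW.
  have Fb a := @concave_test_bounds R c K dl z c01 dlge dl1 z0 a.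
  rewrite /I /weighted_mass addr0 (big_rem o) //= gdistxx.
  rewrite {1}/cutoff big_ord0 mul0r !subr0 expr1n mulr1.
  apply: (@le_trans _ _ (vertex_measure G o * concave_test c K dl z (u t o))).
    rewrite ler_wpM2l ?vertex_measure_ge0 //.
    by case/andP: (Fb _ (u_ge0 o t0)).
  rewrite lerDl; apply: sumr_ge0 => x _.
  apply: mulr_ge0 (vertex_measure_ge0 _ _) _; apply: mulr_ge0.
    by case/andP: (Fb _ (u_ge0 x t0)) => + _; apply: le_trans; exact: u_ge0.
  by apply: exprn_ge0; case/andP: (pB x).
apply: (le_trans Istart); apply: (le_trans (tele (4 ^ K)%N)).
rewrite Iend add0r {Istart Iend tele step}.
have -> : \sum_(m < 4 ^ K) E m = 2 * C * \sum_(m < 4 ^ K) \sum_(x <- B)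
    vertex_measure G x * e (gdist G o x ^ 2 + m)%N.
  rewrite mulr_sumr; apply: eq_bigr => m _; rewrite mulr_sumr.
  by apply: eq_bigr => x _; ring.
rewrite ler_wpM2l ?mulr_ge0 //; exact: error_bound.
Qed.

Hypothesis vol_div : (\sum_(1 <= n <oo)
  (n%:R / set_measure G (gball G o n) `^ (q - 1))%:E = +oo)%E.

Lemma solution_vanishes_centre (t : R) : 0 < t -> u t o = 0.
Proof.
move=> t0; have [C C0 decay] := solution_decay.
apply/eqP; rewrite eq_le u_ge0 // andbT leNgt; apply/negP => ut.
have q10 : 0 < q - 1 by rewrite subr_gt0.
pose a := vertex_measure G o * u t o.
have a0 : 0 < a by rewrite mulr_gt0 // vertex_measure_gt0.
have Ca : 0 < C + 1 by lra.
have [K K0 HK] := condensation_unbounded (ltW q10) (ball_volume_gt0 G o)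
  (@ball_volume_mono _ _ G o) vol_div (((C + 1) / a) `^ (q - 1)).
have Ca0 : 0 < (C + 1) / a by rewrite divr_gt0.
have := decay K t K0 t0; rewrite -/a -/(level G o q).
set S := block_sum _ K in HK *.
have S0 : 0 < S by exact: lt_le_trans (powR_gt0 _ Ca0) HK.
have SK : S `^ (- (q - 1)^-1) <= a / (C + 1).
  rewrite powRN -[leRHS]invrK invf_div lef_pV2 ?posrE ?powR_gt0 //.
  have {1}-> : (C + 1) / a = ((C + 1) / a) `^ (q - 1) `^ (q - 1)^-1.
    by rewrite -powRrM divff ?powRr1 ?(ltW Ca0) // gt_eqF.
  apply: ge0_ler_powR => //; rewrite ?nnegrE ?powR_ge0 ?(ltW S0) //.
  by rewrite invr_ge0 ltW.
move=> H; have : a <= C * (a / (C + 1)).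
  by apply: (le_trans H); rewrite ler_wpM2l.
rewrite mulrA ler_pdivlMr // => H2; nra.
Qed.

(** Where u vanishes for all positive times, so do its time derivative and its
    Laplacian, and then its nonnegative values at all the neighbours. *)
Lemma solution_vanishes (t : R) x : 0 < t -> u t x = 0.
Proof.
suff H : forall p y, (forall t : R, 0 < t -> u t y = 0) -> path (adj G) y p ->
    forall t : R, 0 < t -> u t (last y p) = 0.
  have [p [pp <-]] := adj_connected G o x.
  exact: H solution_vanishes_centre pp t.
elim=> [//|y2 p IH] y y0 /= /andP[yy2 pp]; apply: IH pp => {}t {}t0.
have lap0 : laplacian G (u t) y = 0.
  have := u_heat y t0; rewrite (y0 _ t0) powR0; last first.
    by rewrite gt_eqF // (lt_trans ltr01).
  rewrite derive1E (_ : 'D_1 (u ^~ y) t = 0); first by lra.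
  rewrite (@near_eq_derive _ _ _ (u ^~ y) (cst 0)) ?derive_cst //.
  by near=> s; apply: y0; near: s; exact: lt_nbhsr.
have [B uB BB] := ball_seq G y 1.
have yB z : adj G y z -> z \in B.
  move=> yz; apply: BB; rewrite /gball /= -(gdistxx G y); exact: gdist_adj.
have := laplacian_seq (u t) uB yB; rewrite lap0 mulr0 => /esym/eqP.
rewrite psumr_eq0.
  move/allP/(_ _ (yB _ yy2)) => /=; rewrite (y0 _ t0) subr0 mulf_eq0.
  by rewrite gt_eqF ?weight_adj //= => /eqP.
by move=> z _; rewrite (y0 _ t0) subr0 mulr_ge0 ?weight_ge0 // u_ge0.
Unshelve. all: by end_near. Qed.

End Decay.

Theorem corollary1p7 (R : realType) (V : choiceType) (G : weighted_graph R V)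
  (q : R) (o : V) :
  1 < q ->
  (\sum_(1 <= n <oo) (n%:R / set_measure G (gball G o n) `^ (q - 1))%:E
     = +oo)%E ->
  ~ (exists u : R -> V -> R, positive_global_solution G q u) /\
  (forall u0 : V -> R,
     (forall x, 0 <= u0 x) -> (exists x, u0 x != 0) ->
     ~ (exists u : R -> V -> R, nonneg_global_cauchy_solution G q u0 u)).
Proof.
move=> q1 vol_div; split.
  case=> u [u_gt0 u_C1 u_heat].
  have u_ge0 (t : R) x : 0 < t -> 0 <= u t x by move=> t0; exact/ltW/u_gt0.
  have := u_gt0 1 o ltr01.
  by rewrite (solution_vanishes q1 u_ge0 u_C1 u_heat vol_div o ltr01) ltxx.
move=> u0 _ [x u0x] [u [u_nneg u_cont u_C1 u_heat u_init]].
have u_ge0 (t : R) y : 0 < t -> 0 <= u t y by move=> /ltW; exact: u_nneg.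
have vanish := solution_vanishes q1 u_ge0 u_C1 u_heat vol_div x.
have /continuous_within_itvcyP[_ cvg0] := u_cont x.
have lim0 : u t x @[t --> 0^'+] --> (0 : R).
  apply: cvg_near_cst; near=> t; apply: vanish.
  by near: t; exact: nbhs_right_gt.
move/eqP: u0x; apply; rewrite -u_init.
exact: (cvg_unique _ cvg0 lim0).
Unshelve. all: by end_near. Qed.
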